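(* Let $(\mathrm D)$ be a projectively singular system of degree $n$ and let $a\in\mathbb{R}$. The following statements are equivalent: (1) the infinitely removed point lying on the ''extremities'' of the straight line $y=ax$ is an equatorial contact point of $(\mathrm D)$; (2) the point $(\xi,\theta)=(a,0)$ is a contact point of the straight line $\theta=0$ for the first projectively reduced system $$\frac{d\xi}{d\tau}=\sum_{j=0}^{n-1}\theta^{n-j-1}W_j(1,\xi),\qquad \frac{d\theta}{d\tau}=-\sum_{i=0}^n\theta^{n-i}X_i(1,\xi);$$ (3) $\xi=a$ is a solution of the equation $X_n(1,\xi)=0$, and $W_{n-1}(1,a)\neq0$.
   Context: System $(\mathrm D)$ of degree $n$: $\frac{dx}{dt}=X(x,y)=\sum_{k=0}^n X_k(x,y)$, $\frac{dy}{dt}=Y(x,y)=\sum_{k=0}^n Y_k(x,y)$, where $X_k,Y_k$ are real homogeneous polynomials of degree $k$, $X_n$ and $Y_n$ are not both identically zero, and $X,Y$ are relatively prime (no common divisors other than real numbers). Put $W_i(x,y)=xY_i(x,y)-yX_i(x,y)$, $i=0,\dots,n$. The system is projectively singular if $W_n\equiv 0$ on $\mathbb{R}^2$ (this forces $n\ge1$). The projective phase plane $\mathbb{RP}(x,y)$ is the plane $(x,y)$ completed by the line at infinity, with charts $(x,y)$, $(\xi,\theta)=(\frac yx,\frac1x)$, $(\eta,\zeta)=(\frac1y,\frac xy)$; the trajectories in the chart $(\xi,\theta)$ are those of the first projectively reduced system, obtained from $(\mathrm D)$ by $x=\frac1\theta$, $y=\frac\xi\theta$ and removal of the common power of $\theta$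 by a change of time. The point at infinity on the ''extremities'' of the line $y=ax$ is the point at infinity of this line, i.e. $(\xi,\theta)=(a,0)$. A point is regular if it is not an equilibrium. A contact point of a curve $\gamma$ is a regular point of $\gamma$ at which the trajectory through it is tangent to $\gamma$. An equatorial contact point of a projectively singular system is a regular point of the line at infinity at which the trajectory on $\mathbb{RP}(x,y)$ through this point is tangent to the line at infinity. *)

(* Defs.v *)
From HB Require Import structures.
From mathcomp Require Import all_boot all_order all_algebra.
(* The notations of mpoly clash with those of the analysis library. *)
From mathcomp Require Import -(notations) mpoly.
From mathcomp Require Import all_classical all_reals all_analysis.
Import numFieldNormedType.Exports.
Import Order.TTheory GRing.Theory Num.Theory.

Set Implicit Arguments.
Unset Strict Implicit.
Unset Printing Implicit Defensive.

Local Open Scope classical_set_scope.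
Local Open Scope ring_scope.

Definition poly2 (R : realType) := mpoly 2 R.

Definition varx (R : realType) : poly2 R := mpolyX R (mnm1 ord0).
Definition vary (R : realType) : poly2 R := mpolyX R (mnm1 ord_max).

Definition ev (R : realType) (p : poly2 R) (x y : R) : R :=
  meval (fun i : 'I_2 => if i == ord0 then x else y) p.

(* As usual, 0 is homogeneous of every degree. *)
Definition homogeneous (R : realType) (k : nat) (p : poly2 R) : Prop :=
  p \is ishomog1 k (@mdeg 2).

Definition divides (R : realType) (d p : poly2 R) : Prop :=
  exists q : poly2 R, p = d * q.

Definition relatively_prime (R : realType) (p q : poly2 R) : Prop :=
  forall d : poly2 R, divides d p -> divides d q ->
    exists c : R, d = mpolyC 2 c.

(* Only the values of compX and compY at indices k <= n are meaningful. *)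
Record system (R : realType) (n : nat) := System {
  compX : nat -> poly2 R;
  compY : nat -> poly2 R;
  compX_homog : forall k, (k <= n)%N -> homogeneous k (compX k);
  compY_homog : forall k, (k <= n)%N -> homogeneous k (compY k);
  comp_top : ~ (compX n = 0 /\ compY n = 0);
  comp_coprime : relatively_prime (\sum_(0 <= k < n.+1) compX k)
                                  (\sum_(0 <= k < n.+1) compY k) }.

Definition polyX (R : realType) (n : nat) (D : system R n) : poly2 R :=
  \sum_(0 <= k < n.+1) compX D k.
Definition polyY (R : realType) (n : nat) (D : system R n) : poly2 R :=
  \sum_(0 <= k < n.+1) compY D k.

Definition compW (R : realType) (n : nat) (D : system R n) (i : nat) : poly2 R :=
  varx R * compY D i - vary R * compX D i.

Definition projectively_singular (R : realType) (n : nat) (D : system R n) : Prop :=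
  forall x y : R, ev (compW D n) x y = 0.

(** Trajectories and contact points in the plane *)

Definition vfield (R : realType) := (R * R -> R * R)%type.

Definition polyfield (R : realType) (P Q : poly2 R) : vfield R :=
  fun u => (ev P u.1 u.2, ev Q u.1 u.2).

(* A solution of u' = F(u) near time 0; its image is the arc around g 0 of the
   trajectory through g 0. *)
Definition solution (R : realType) (F : vfield R) (g : R -> R * R) : Prop :=
  \forall t \near (0 : R), is_derive (t : R) (1 : R) g (F (g t)).

(* The arc g is tangent at time 0 to the curve L: it has there a nonzero
   velocity v, collinear with a nonzero velocity w at the same point of some
   arc s drawn on L. *)
Definition tangent_to (R : realType) (L : set (R * R)) (g : R -> R * R) : Prop :=
  exists (s : R -> R * R) (v w : R * R),
    [/\ s 0 = g 0,
        \forall t \near (0 : R), L (s t),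
        is_derive (0 : R) (1 : R) g v /\ is_derive (0 : R) (1 : R) s w,
        v != 0 /\ w != 0
      & v.1 * w.2 - v.2 * w.1 = 0].

Definition contact_point (R : realType) (F : vfield R) (L : set (R * R))
    (u : R * R) : Prop :=
  [/\ L u, F u <> 0 &
      exists g : R -> R * R, [/\ solution F g, g 0 = u & tangent_to L g]].

(** The projective phase plane *)

(* The plane completed by the line at infinity, whose points correspond to the
   directions of lines: [Infinite a] is the common point at infinity of the
   lines y = a x + b, [InfiniteVertical] that of the lines x = b. *)
Inductive RP (R : realType) :=
| Finite of R * R
| Infinite of R
| InfiniteVertical.
Arguments InfiniteVertical {R}.

Definition line_at_infinity (R : realType) : set (RP R) :=
  fun p => if p is Finite _ then False else True.

(* Chart_x has coordinates (xi, theta) = (y/x, 1/x),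
   Chart_y has coordinates (eta, zeta) = (1/y, x/y). *)
Inductive chart := Chart_xy | Chart_x | Chart_y.

(* Equation of the line at infinity in the chart c. *)
Definition inf_coord (R : realType) (c : chart) (u : R * R) : R :=
  match c with Chart_xy => 1 | Chart_x => u.2 | Chart_y => u.1 end.

(* The change of variables to (x, y): x = 1/theta, y = xi/theta, resp.
   x = zeta/eta, y = 1/eta. *)
Definition to_xy (R : realType) (c : chart) (u : R * R) : R * R :=
  match c with
  | Chart_xy => u
  | Chart_x => (u.2^-1, u.1 / u.2)
  | Chart_y => (u.2 / u.1, u.1^-1)
  end.

(* The point of the projective plane with coordinates u in the chart c. On
   Chart_y, (0, zeta) with zeta <> 0 is the point (xi, theta) = (1/zeta, 0). *)
Definition point_of (R : realType) (c : chart) (u : R * R) : RP R :=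
  if inf_coord c u == 0 then
    match c with
    | Chart_xy => Finite u
    | Chart_x => Infinite u.1
    | Chart_y => if u.2 == 0 then InfiniteVertical else Infinite u.2^-1
    end
  else Finite (to_xy c u).

(* The polynomial system (P, Q) is what (D) becomes in the chart c: the change
   of variables carries it to (D) multiplied by a power m of the inf_coord (this
   is the change of time), and all common powers of inf_coord are removed, i.e.
   (P, Q) does not vanish identically on inf_coord = 0. *)
Definition reduced_system (R : realType) (n : nat) (D : system R n) (c : chart)
    (P Q : poly2 R) : Prop :=
  match c with
  | Chart_xy => P = polyX D /\ Q = polyY D
  | _ =>
    (exists m : int, forall u : R * R, inf_coord c u != 0 ->
       is_derive u (polyfield P Q u) (@to_xy R c)
         ((inf_coord c u ^ m) *: polyfield (polyX D) (polyY D) (to_xy c u)))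
    /\ (exists u : R * R, inf_coord c u = 0 /\ polyfield P Q u <> 0)
  end.

Definition RP_equilibrium (R : realType) (n : nat) (D : system R n) (p : RP R)
    : Prop :=
  exists (c : chart) (P Q : poly2 R) (u : R * R),
    [/\ reduced_system D c P Q, point_of c u = p & polyfield P Q u = 0].

(* The arc k, around k 0, of a trajectory on the projective plane. *)
Definition RP_trajectory (R : realType) (n : nat) (D : system R n) (k : R -> RP R)
    : Prop :=
  exists (c : chart) (P Q : poly2 R) (g : R -> R * R),
    [/\ reduced_system D c P Q, solution (polyfield P Q) g &
        \forall t \near (0 : R), k t = point_of c (g t)].

Definition RP_tangent_to (R : realType) (L : set (RP R)) (k : R -> RP R) : Prop :=
  exists (c : chart) (g : R -> R * R),
    (\forall t \near (0 : R), k t = point_of c (g t)) /\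
    tangent_to (@point_of R c @^-1` L) g.

Definition equatorial_contact_point (R : realType) (n : nat) (D : system R n)
    (p : RP R) : Prop :=
  [/\ line_at_infinity p, ~ RP_equilibrium D p &
      exists k : R -> RP R,
        [/\ RP_trajectory D k, k 0 = p & RP_tangent_to (@line_at_infinity R) k]].

(* For projectively singular systems: d xi / d tau, d theta / d tau. *)
Definition first_reduced_field (R : realType) (n : nat) (D : system R n) : vfield R :=
  fun u => let: (xi, theta) := u in
    (\sum_(0 <= j < n) theta ^+ (n - j - 1) * ev (compW D j) 1 xi,
     - \sum_(0 <= i < n.+1) theta ^+ (n - i) * ev (compX D i) 1 xi).

(* Main.v *)
Require Import Defs.
From HB Require Import structures.
From mathcomp Require Import all_boot all_order all_algebra.
From mathcomp Require Import -(notations) mpoly.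
From mathcomp Require Import all_classical all_reals all_analysis.
From mathcomp Require Import ring lra.
Import numFieldNormedType.Exports.
Import Order.TTheory GRing.Theory Num.Theory.

Set Implicit Arguments.
Unset Strict Implicit.
Unset Printing Implicit Defensive.

Local Open Scope classical_set_scope.
Local Open Scope ring_scope.

(** Both contact conditions are shown to be equivalent to the algebraic one,
    [contact_condition].

    In the chart (xi, theta) the change of variables x = 1/theta,
    y = xi/theta carries (D) to the first reduced field, up to the factor
    theta^(n-2) ([dto_xy_chart_field]): the would-be pole W_n(1, xi) / theta
    vanishes because W_n = 0.  On theta = 0 this field equals
    (W_{n-1}(1, xi), - X_n(1, xi)).  Hence (a, 0) is regular and the field there
    is horizontal exactly when X_n(1, a) = 0 and W_{n-1}(1, a) <> 0, which is
    the tangency with theta = 0 as soon as some trajectory passes through (a, 0)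
    ([contact_pointE]).  That a trajectory exists is the theorem of Picard and
    Lindelof for polynomial fields ([polyfield_solution]): the Picard iterates
    of a polynomial field are polynomial curves, so each integration is a formal
    primitive, and the limit is differentiated through a quadratic
    remainder estimate that is uniform along the iteration.

    Equatorial contact quantifies over all charts, all reduced systems in them
    and all parametrizations.  Two facts remove this freedom.  A reduced system
    in a chart at infinity is unique ([reduced_system_unique]): two of them
    differ by a power of the equation of the line at infinity, and neither
    vanishes identically on that line, so the power is trivial.  And the
    function 1/x extends by 0 to the line at infinity ([theta]); along an arc
    through the point at infinity of y = ax it is differentiable in every chart.
    Its derivative is a nonzero multiple of X_n(1, a) for a trajectory
    ([trajectory_theta]), and 0 for an arc tangent to the line at infinity
    ([tangent_theta]). *)

(** * Directional derivatives of pairs and quotients *)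

Lemma is_derive_cvg (R : realType) (V W : normedModType R) (f : V -> W)
    (x v : V) (d : W) :
  is_derive x v f d <->
  h^-1 *: (f (h *: v + x) - f x) @[h --> (0 : R)^'] --> d.
Proof.
split=> [[df <-]|cf]; first exact: df.
by split; [exact: (cvgP _ cf)|exact: cvg_lim cf].
Qed.

Lemma is_derive_pair (R : realType) (V : normedModType R) (f g : V -> R)
    (x v : V) (a b : R) :
  is_derive x v f a -> is_derive x v g b ->
  is_derive x v (fun y => (f y, g y)) (a, b).
Proof.
move=> /is_derive_cvg cf /is_derive_cvg cg; apply/is_derive_cvg.
exact: cvg_pair cf cg.
Qed.

Lemma is_derive_fst (R : realType) (V : normedModType R) (f : V -> R * R)
    (x v : V) (d : R * R) :
  is_derive x v f d -> is_derive x v (fun y => (f y).1) d.1.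
Proof.
move=> /is_derive_cvg cf; apply/is_derive_cvg.
exact: cvg_comp cf (@cvg_fst _ _ (nbhs d.1) (nbhs d.2) _).
Qed.

Lemma is_derive_snd (R : realType) (V : normedModType R) (f : V -> R * R)
    (x v : V) (d : R * R) :
  is_derive x v f d -> is_derive x v (fun y => (f y).2) d.2.
Proof.
move=> /is_derive_cvg cf; apply/is_derive_cvg.
exact: cvg_comp cf (@cvg_snd _ _ (nbhs d.1) (nbhs d.2) _).
Qed.

Lemma is_derive_unique (R : realType) (V W : normedModType R) (f : V -> W)
    (x v : V) (d e : W) :
  is_derive x v f d -> is_derive x v f e -> d = e.
Proof. by move=> [_ <-] [_ <-]. Qed.

Lemma is_derive_div (R : realType) (V : normedModType R) (f g : V -> R)
    (x v : V) (a b : R) :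
  g x != 0 -> is_derive x v f a -> is_derive x v g b ->
  is_derive x v (fun y => f y / g y) (a / g x - f x * b / g x ^+ 2).
Proof.
move=> gx0 df dg.
have dV : is_derive x v (fun y => (g y)^-1) (- g x ^- 2 *: b).
  split; first by apply: derivableV => //; case: dg.
  by rewrite deriveV //; case: dg => _ ->.
apply: is_derive_eq; rewrite /GRing.scale /=; field.
exact: gx0.
Qed.

(** * Local solutions by Picard iteration *)

Lemma le_pair_norm (R : realType) (u : R * R) (c : R) :
  (`|u| <= c) = (`|u.1| <= c) && (`|u.2| <= c).
Proof. by rewrite prod_normE /= ge_max. Qed.

(** The two inequalities on r say that r lies between s and t. *)
Lemma mvt_bound1 (R : realType) (f f' : R -> R) (s t C : R) :
  (forall r, is_derive (r : R) (1 : R) f (f' r)) ->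
  (forall r, `|r - s| <= `|t - s| -> `|r - t| <= `|t - s| -> `|f' r| <= C) ->
  `|f t - f s| <= C * `|t - s|.
Proof.
move=> df; wlog st : s t / s <= t => [wlg|] bnd.
  have [st|/ltW ts] := leP s t; first exact: wlg.
  rewrite distrC (distrC t); apply: wlg => // r r1 r2.
  by apply: bnd; rewrite (distrC t).
have fc : {within `[s, t], continuous f}.
  apply: continuous_subspaceT => x.
  exact/differentiable_continuous/derivable1_diffP/(@ex_derive _ _ _ _ _ _ _ (df x)).
have [c] := MVT_segment st (fun x _ => df x) fc.
rewrite in_itv /= => /andP[sc ct] ->.
rewrite normrM ler_wpM2r// bnd// [`|t - s|]ger0_norm ?subr_ge0// ler_norml; lra.
Qed.

Lemma mvt_bound (R : realType) (f f' : R -> R * R) (s t C : R) :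
  (forall r, is_derive (r : R) (1 : R) f (f' r)) ->
  (forall r, `|r - s| <= `|t - s| -> `|r - t| <= `|t - s| -> `|f' r| <= C) ->
  `|f t - f s| <= C * `|t - s|.
Proof.
move=> df bnd; rewrite le_pair_norm; apply/andP; split=> /=.
  apply: (@mvt_bound1 _ (fun y => (f y).1) (fun y => (f' y).1)) => r.
    exact: is_derive_fst.
  by move=> r1 r2; have := bnd _ r1 r2; rewrite le_pair_norm => /andP[].
apply: (@mvt_bound1 _ (fun y => (f y).2) (fun y => (f' y).2)) => r.
  exact: is_derive_snd.
by move=> r1 r2; have := bnd _ r1 r2; rewrite le_pair_norm => /andP[].
Qed.

(** A quadratic remainder is a closed condition on [f], stable under pointwise
    limits, whereas differentiability is not. *)
Lemma is_derive_quadratic (R : realType) (W : normedModType R) (f : R -> W)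
    (s C : R) (d : W) :
  (\forall h \near (0 : R), `|f (h + s) - f s - h *: d| <= C * `|h| ^+ 2) ->
  is_derive (s : R) (1 : R) f d.
Proof.
move=> fC; apply/is_derive_cvg/cvgrPdist_le => e e0.
have C1 : 0 < `|C| + 1 by rewrite ltr_wpDl.
near=> h.
have h0 : h != 0 by near: h; exact: nbhs_dnbhs_neq.
have hn : 0 < `|h| by rewrite normr_gt0.
have -> : d - h^-1 *: (f (h *: (1 : R) + s) - f s) =
   - (h^-1 *: (f (h + s) - f s - h *: d)).
  by rewrite [h *: 1]mulr1 [X in _ = - X]scalerBr scalerA mulVf// scale1r opprB.
rewrite normrN normrZ normfV ler_pdivrMl//.
have fh : `|f (h + s) - f s - h *: d| <= C * `|h| ^+ 2.
  by near: h; exact: nbhs_dnbhs.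
have he : `|h| <= e / (`|C| + 1).
  near: h; apply: dnbhs0_le; exact: divr_gt0.
apply: (le_trans fh); rewrite expr2 mulrCA ler_wpM2l//.
move: he; rewrite ler_pdivlMr// => he; apply: le_trans he.
rewrite mulrC ler_wpM2l//; have := ler_norm C; lra.
Unshelve. all: by end_near. Qed.

(** The curves [g k] are Picard iterates of [F] from [u0], given by their
    differential equations instead of integrals, so that any class of curves
    with primitives can supply them. *)
Section picard_iteration.
Variables (R : realType) (F : R * R -> R * R) (u0 : R * R) (M : R).
Variable g : nat -> R -> R * R.
Hypothesis M0 : 0 < M.
Hypothesis FM : forall u, `|u - u0| <= 1 -> `|F u| <= M.
Hypothesis FL : forall u v, `|u - u0| <= 1 -> `|v - u0| <= 1 ->
  `|F u - F v| <= M * `|u - v|.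
Hypothesis g0 : forall t, g 0 t = u0.
Hypothesis gk0 : forall k, g k 0 = u0.
Hypothesis dg : forall k t, is_derive (t : R) (1 : R) (g k.+1) (F (g k t)).

(* On |t| <= delta the iterates cannot leave the unit ball, and the Picard
   operator contracts by 1/2. *)
Let delta := (2 * M)^-1.

Let Mdelta : M * delta = 2^-1.
Proof. by rewrite /delta invfM mulrCA divff ?mulr1// gt_eqF. Qed.

Let delta0 : 0 < delta. Proof. by rewrite invr_gt0 mulr_gt0. Qed.

Let box k t : `|t| <= delta -> `|g k t - u0| <= 1.
Proof.
elim: k t => [|k IH] t td; first by rewrite g0 subrr normr0.
rewrite -(gk0 k.+1); apply: (@le_trans _ _ (M * `|t - 0|)).
  apply: mvt_bound => r.
  by rewrite !subr0 => r1 _; apply/FM/IH/(le_trans r1).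
rewrite subr0; apply: (@le_trans _ _ (M * delta)); first by rewrite ler_wpM2l// ltW.
by rewrite Mdelta; lra.
Qed.

Let step k t : `|t| <= delta -> `|g k.+1 t - g k t| <= 2^-1 ^+ k.
Proof.
elim: k t => [|k IH] t td; first by rewrite g0 expr0 box.
have := @mvt_bound R (fun r => g k.+2 r - g k.+1 r)
  (fun r => F (g k.+1 r) - F (g k r)) 0 t (M * 2^-1 ^+ k).
rewrite !gk0 subrr !subr0 => /(_ (fun r => is_deriveB (dg _ _) (dg _ _))) H.
have /H {}H : forall r, `|r - 0| <= `|t| -> `|r - t| <= `|t| ->
    `|F (g k.+1 r) - F (g k r)| <= M * 2^-1 ^+ k.
  move=> r; rewrite subr0 => rt _; have rd := le_trans rt td.
  by apply: (le_trans (FL (box _ rd) (box _ rd))); rewrite ler_wpM2l ?IH// ltW.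
apply: (le_trans H); rewrite mulrAC exprS ler_wpM2r ?exprn_ge0 ?invr_ge0//.
by rewrite -Mdelta ler_wpM2l// ltW.
Qed.

Let G t := (lim ((g k t).1 @[k --> \oo]), lim ((g k t).2 @[k --> \oo])).

Let cvg_dominated (u : R^nat) :
  (forall k, `|u k.+1 - u k| <= 2^-1 ^+ k) -> cvgn u.
Proof.
move=> us; have -> : u = cst (u 0) + series (telescope u).
  by apply/funext => k; rewrite [LHS](@eq_sum_telescope _ u).
apply: is_cvgD; first exact: is_cvg_cst.
apply: normed_cvg.
apply: (@series_le_cvg _ _ (geometric 1 2^-1)) => [k|k|k|] /=; rewrite ?mulr_ge0//.
- by rewrite mul1r; exact: us.
- by apply: is_cvg_geometric_series; rewrite ger0_norm ?invr_ge0// invf_lt1//; lra.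
Qed.

Let g_cvg t : `|t| <= delta -> g k t @[k --> \oo] --> G t.
Proof.
move=> td; have -> : (fun k => g k t) = (fun k => ((g k t).1, (g k t).2)).
  by apply/funext => k; case: (g k t).
have c1 : cvgn (fun k => (g k t).1).
  by apply: cvg_dominated => k; have := step k td; rewrite le_pair_norm => /andP[].
have c2 : cvgn (fun k => (g k t).2).
  by apply: cvg_dominated => k; have := step k td; rewrite le_pair_norm => /andP[].
exact: cvg_pair c1 c2.
Qed.

Let FG_cvg t : `|t| <= delta -> F (g k t) @[k --> \oo] --> F (G t).
Proof.
move=> td; have gG := g_cvg td.
have Gbox : `|G t - u0| <= 1.
  have -> : `|G t - u0| = lim (`|g k t - u0| @[k --> \oo]).
    apply/esym/cvg_lim => //; apply: cvg_norm; apply: cvgB => //; exact: cvg_cst.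
  apply: limr_le; first by apply: is_cvg_norm; apply/cvgP; apply: cvgB; [exact: gG|exact: cvg_cst].
  by near=> k; exact: box.
apply/cvgrPdist_le => e e0.
near=> k.
apply: (le_trans (FL Gbox (box _ td))).
rewrite mulrC -ler_pdivlMr//.
near: k; move/cvgrPdist_le : gG; apply; exact: divr_gt0.
Unshelve. all: by end_near. Qed.

(** The derivative of r |-> g_{k+2}(r) - r F(g_{k+1}(s)) is
    F(g_{k+1}(r)) - F(g_{k+1}(s)), which is O(|r - s|) uniformly in k because F is
    Lipschitz and the iterates have speed at most M. *)
Let linearize_iter k s t : `|s| <= delta -> `|t| <= delta ->
  `|g k.+2 t - g k.+2 s - (t - s) *: F (g k.+1 s)| <= M ^+ 2 * `|t - s| ^+ 2.
Proof.
move=> sd td; pose c := F (g k.+1 s).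
have dl r : is_derive (r : R) (1 : R) (fun r => g k.+2 r - r *: c) (F (g k.+1 r) - c).
  apply: is_deriveB; apply/is_derive_cvg; apply/cvgrPdist_le => e e0.
  near=> h.
  have h0 : h != 0 by near: h; exact: nbhs_dnbhs_neq.
  by rewrite [h *: 1]mulr1 -scalerBl addrK scalerA mulVf// scale1r subrr normr0 ltW.
have := @mvt_bound R _ _ s t (M ^+ 2 * `|t - s|) dl.
have -> : g k.+2 t - t *: c - (g k.+2 s - s *: c) =
          g k.+2 t - g k.+2 s - (t - s) *: c.
  by rewrite scalerBl !opprB addrACA [RHS]addrACA [X in _ + X]addrC.
rewrite [_ * `|t - s| ^+ 2]mulrA -/c; apply=> r r1 r2.
have rd : `|r| <= delta.
  move: sd td r1 r2; rewrite !ler_norml => /andP[? ?] /andP[? ?] r1 r2.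
  have [ts|/ltW ts] := leP s t.
    by move: r1 r2; rewrite ger0_norm ?subr_ge0//; lra.
  by move: r1 r2; rewrite ler0_norm ?subr_le0//; lra.
apply: (le_trans (FL (box _ rd) (box _ sd))).
rewrite expr2 -mulrA ler_wpM2l ?(ltW M0)//.
apply: (@le_trans _ _ (M * `|r - s|)); last by rewrite ler_wpM2l// ltW.
apply: mvt_bound => x x1 x2.
apply/FM/box.
move: sd rd x1 x2; rewrite !ler_norml => /andP[? ?] /andP[? ?] x1 x2.
have [ts|/ltW ts] := leP s r.
  by move: x1 x2; rewrite ger0_norm ?subr_ge0//; lra.
by move: x1 x2; rewrite ler0_norm ?subr_le0//; lra.
Unshelve. all: by end_near. Qed.

(** The bound of [linearize_iter] is uniform in k, so pointwise convergence of
    the iterates carries it to the limit. *)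
Let linearize s t : `|s| <= delta -> `|t| <= delta ->
  `|G t - G s - (t - s) *: F (G s)| <= M ^+ 2 * `|t - s| ^+ 2.
Proof.
move=> sd td.
have cv : `|g k.+2 t - g k.+2 s - (t - s) *: F (g k.+1 s)| @[k --> \oo] -->
          `|G t - G s - (t - s) *: F (G s)|.
  apply: cvg_norm; apply: cvgB; first apply: cvgB.
  - exact: (cvg_comp (addn 2) (fun k => g k t)) (cvg_addnl 2) (g_cvg td).
  - exact: (cvg_comp (addn 2) (fun k => g k s)) (cvg_addnl 2) (g_cvg sd).
  - apply: cvgZl_tmp.
    exact: (cvg_comp (addn 1) (fun k => F (g k s))) (cvg_addnl 1) (FG_cvg sd).
rewrite -(cvg_lim _ cv)//; apply: limr_le; first exact: cvgP cv.
by near=> k; exact: linearize_iter.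
Unshelve. all: by end_near. Qed.

Lemma picard_limit : exists h : R -> R * R,
  h 0 = u0 /\ \forall t \near (0 : R), is_derive (t : R) (1 : R) h (F (h t)).
Proof.
exists G; split.
  rewrite /G [RHS]surjective_pairing; congr pair; apply: cvg_lim => //;
    by under eq_fun do rewrite gk0; exact: cvg_cst.
near=> t.
have td : `|t| < delta by near: t; exact: (@nbhs0_lt R R^o).
apply: (@is_derive_quadratic _ _ _ _ (M ^+ 2)).
near=> h.
have := @linearize t (h + t) (ltW td); rewrite addrK; apply.
apply: (le_trans (ler_normD _ _)); rewrite -lerBrDr.
by near: h; apply: (@nbhs0_le R R^o); rewrite subr_gt0.
Unshelve. all: by end_near. Qed.

End picard_iteration.

(** * Polynomials in two variables *)

Section evaluation.
Variable R : realType.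
Implicit Types (p q : poly2 R) (x y l : R).

Lemma poly2_ind (Pr : poly2 R -> Prop) :
  (forall c, Pr (mpolyC 2 c)) -> Pr (varx R) -> Pr (vary R) ->
  (forall p q, Pr p -> Pr q -> Pr (p + q)) ->
  (forall p q, Pr p -> Pr q -> Pr (p * q)) -> forall p, Pr p.
Proof.
move=> PC Px Py PD PM; elim/mpolyind => [|c m p _ _ Pp].
  by rewrite -(mpolyC0 2); exact: PC.
apply: (PD) => //; rewrite -mul_mpolyC; apply: (PM); first exact: (PC).
rewrite mpolyXE_id; apply: big_ind => [||i _]; first by rewrite -(mpolyC1 2); exact: PC.
  exact: PM.
have Pi : Pr (mpolyX R (mnm1 i)).
  case: i => -[|[|//]] i2.
    by rewrite (_ : Ordinal i2 = ord0) //; exact: val_inj.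
  by rewrite (_ : Ordinal i2 = ord_max) //; exact: val_inj.
elim: (m i) => [|k IH]; first by rewrite expr0 -(mpolyC1 2); exact: PC.
by rewrite exprS; exact: PM.
Qed.

Lemma evC c x y : ev (mpolyC 2 c) x y = c. Proof. exact: mevalC. Qed.
Lemma evx x y : ev (varx R) x y = x. Proof. exact: mevalXU. Qed.
Lemma evy x y : ev (vary R) x y = y. Proof. exact: mevalXU. Qed.
Lemma evD p q x y : ev (p + q) x y = ev p x y + ev q x y.
Proof. exact: mevalD. Qed.
Lemma evN p x y : ev (- p) x y = - ev p x y.
Proof. exact: mevalN. Qed.
Lemma evB p q x y : ev (p - q) x y = ev p x y - ev q x y.
Proof. exact: mevalB. Qed.
Lemma evM p q x y : ev (p * q) x y = ev p x y * ev q x y.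
Proof. exact: mevalM. Qed.
Lemma evZ c p x y : ev (c *: p) x y = c * ev p x y.
Proof. exact: mevalZ. Qed.
Lemma evXn p k x y : ev (p ^+ k) x y = ev p x y ^+ k.
Proof. exact: rmorphXn. Qed.
Lemma ev_sum (f : nat -> poly2 R) m n x y :
  ev (\sum_(m <= i < n) f i) x y = \sum_(m <= i < n) ev (f i) x y.
Proof. exact: raddf_sum. Qed.

Lemma evE p x y :
  ev p x y = \sum_(m <- msupp p) mcoeff m p * (x ^+ m ord0 * y ^+ m ord_max).
Proof.
rewrite /ev mevalE; apply: eq_bigr => m _; congr (_ * _).
rewrite big_ord_recl big_ord1; congr (_ * y ^+ m _); exact: val_inj.
Qed.

Lemma mdeg2 (m : multinom 2) : mdeg m = (m ord0 + m ord_max)%N.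
Proof.
rewrite mdegE big_ord_recl big_ord1; congr (_ + m _)%N; exact: val_inj.
Qed.

Lemma homogeneousP k p : homogeneous k p ->
  {in msupp p, forall m : multinom 2, (m ord0 + m ord_max = k)%N}.
Proof. by move=> /dhomogP hp m /hp; rewrite -mdeg2. Qed.

Lemma ev_homog k p l x y : homogeneous k p ->
  ev p (l * x) (l * y) = l ^+ k * ev p x y.
Proof.
move=> /homogeneousP hp; rewrite !evE mulr_sumr; apply: eq_big_seq => m mp.
by rewrite -(hp _ mp) !exprMn exprD; ring.
Qed.

(** Substitution into an algebra: with [A] the univariate polynomials it gives
    the restriction of p to a polynomial curve, with [A] the polynomials in two
    variables a polynomial change of variables. *)
Definition poly2_comp (A : algType R) p (f g : A) : A :=
  \sum_(m <- msupp p) mcoeff m p *: (f ^+ m ord0 * g ^+ m ord_max).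

Lemma horner_poly2_comp p (f g : {poly R}) t :
  (poly2_comp p f g).[t] = ev p f.[t] g.[t].
Proof.
by rewrite evE horner_sum; apply: eq_bigr => m _; rewrite !hornerE.
Qed.

Lemma ev_poly2_comp p (f g : poly2 R) x y :
  ev (poly2_comp p f g) x y = ev p (ev f x y) (ev g x y).
Proof.
rewrite [RHS]evE [LHS]raddf_sum; apply: eq_bigr => m _.
by rewrite -[LHS]/(ev _ x y) evZ evM !evXn.
Qed.

(** The numbers 1, 2, ..., size f would be too many roots. *)
Lemma poly_eq0 (f : {poly R}) : (forall x, x != 0 -> f.[x] = 0) -> f = 0.
Proof.
move=> f0; apply/eqP/negPn/negP => fn0.
have := @max_poly_roots _ f [seq i.+1%:R | i <- iota 0 (size f)] fn0.
rewrite size_map size_iota ltnn => noroots; suff : false by []; apply: noroots.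
  by apply/allP => _ /mapP[i _ ->]; rewrite /root f0// pnatr_eq0.
by rewrite map_inj_uniq ?iota_uniq// => i j /eqP; rewrite eqr_nat => /eqP [].
Qed.

(** Distinct monomials of the same degree have distinct exponents in y, so
    dehomogenizing at x = 1 loses no coefficient. *)
Lemma homog_eq0 k p : homogeneous k p ->
  (forall x, x != 0 -> ev p 1 x = 0) -> p = 0.
Proof.
move=> /homogeneousP hp p0; pose f : {poly R} := poly2_comp p 1 'X.
have f0 : f = 0.
  by apply: poly_eq0 => x x0; rewrite horner_poly2_comp hornerC hornerX p0.
apply/mpolyP => m; rewrite mcoeff0.
have [mp|/memN_msupp_eq0//] := boolP (m \in msupp p).
have : f`_(m ord_max) = 0 by rewrite f0 coef0.
rewrite coef_sum (bigD1_seq m) //= ?msupp_uniq// big1_seq ?addr0.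
  by rewrite expr1n mul1r coefZ coefXn eqxx mulr1.
move=> m' /andP[m'm m'p]; rewrite expr1n mul1r coefZ coefXn.
case: eqP => [e|_]; rewrite ?mulr0//; case/eqP: m'm.
have := hp _ m'p; rewrite -(hp _ mp) e => /addIn e0.
apply/mnmP => -[[|[|//]] i2].
  by rewrite (_ : Ordinal i2 = ord0) //; exact: val_inj.
by rewrite (_ : Ordinal i2 = ord_max) //; exact: val_inj.
Qed.

(** Bound and Lipschitz constant are carried together, since the Lipschitz
    constant of a product uses the bounds of both factors. *)
Lemma ev_lipschitz p (r : R) : exists2 M : R, 0 <= M &
  (forall u : R * R, `|u| <= r -> `|ev p u.1 u.2| <= M) /\
  (forall u v : R * R, `|u| <= r -> `|v| <= r ->
     `|ev p u.1 u.2 - ev p v.1 v.2| <= M * `|u - v|).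
Proof.
elim/poly2_ind: p => [c|||p q [M M0 [pM pL]] [N N0 [qN qL]]|p q [M M0 [pM pL]] [N N0 [qN qL]]].
- exists `|c| => //; split => [u _|u v _ _]; first by rewrite evC.
  by rewrite !evC subrr normr0 mulr_ge0.
- exists (`|r| + 1); first by rewrite addr_ge0.
  split => [u|u v _ _]; rewrite !evx.
    by rewrite le_pair_norm => /andP[ur _]; have := ler_norm r; lra.
  have : `|u - v| <= `|u - v| by [].
  rewrite {1}le_pair_norm => /andP[/= uv _]; apply: (le_trans uv).
  by rewrite ler_peMl// lerDr.
- exists (`|r| + 1); first by rewrite addr_ge0.
  split => [u|u v _ _]; rewrite !evy.
    by rewrite le_pair_norm => /andP[_ ur]; have := ler_norm r; lra.
  have : `|u - v| <= `|u - v| by [].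
  rewrite {1}le_pair_norm => /andP[/= _ uv]; apply: (le_trans uv).
  by rewrite ler_peMl// lerDr.
- exists (M + N); first exact: addr_ge0.
  split => [u ur|u v ur vr]; rewrite !evD.
    by apply: (le_trans (ler_normD _ _)); apply: lerD; [exact: pM|exact: qN].
  rewrite opprD addrACA; apply: (le_trans (ler_normD _ _)); rewrite mulrDl.
  by apply: lerD; [exact: pL|exact: qL].
- exists (M * N + (N * M + M * N)); first by rewrite !addr_ge0 ?mulr_ge0.
  split => [u ur|u v ur vr]; rewrite !evM.
    rewrite normrM; apply: (@le_trans _ _ (M * N)).
      by apply: ler_pM => //; [exact: pM|exact: qN].
    by rewrite lerDl addr_ge0 ?mulr_ge0.
  rewrite (_ : _ - _ = ev q u.1 u.2 * (ev p u.1 u.2 - ev p v.1 v.2) +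
     ev p v.1 v.2 * (ev q u.1 u.2 - ev q v.1 v.2)); last by ring.
  apply: (le_trans (ler_normD _ _)); rewrite mulrDl.
  apply: ler_wpDl; first by rewrite !mulr_ge0.
  by rewrite mulrDl -!mulrA; apply: lerD; rewrite normrM;
    apply: ler_pM => //; [exact: qN|exact: pL|exact: pM|exact: qL].
Qed.

(* The default value f`_(0.-1) / 0 = 0 at index 0 leaves [c] as constant term. *)
Definition primitive (c : R) (f : {poly R}) : {poly R} :=
  c%:P + \poly_(i < (size f).+1) (f`_i.-1 / i%:R).

Lemma horner0_primitive c f : (primitive c f).[0] = c.
Proof.
by rewrite hornerD hornerC horner_coef0 coef_poly/= invr0 mulr0 addr0.
Qed.

Lemma deriv_primitive c f : (primitive c f)^`() = f.
Proof.
apply/polyP => i; rewrite derivD derivC add0r coef_deriv coef_poly ltnS.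
case: ltnP => [_|fi]; last by rewrite mul0rn nth_default.
by rewrite /= -[LHS]mulr_natr divfK// pnatr_eq0.
Qed.

Lemma is_derive_primitive c f (t : R) :
  is_derive t (1 : R) (horner (primitive c f)) f.[t].
Proof. by have := is_derive_poly (primitive c f) t; rewrite deriv_primitive. Qed.

(** The field keeps polynomial curves polynomial, so that the Picard iterates
    are obtained with [primitive] alone. *)
Theorem polyfield_solution (P Q : poly2 R) (u0 : R * R) :
  exists g : R -> R * R, solution (polyfield P Q) g /\ g 0 = u0.
Proof.
pose step (f : {poly R} * {poly R}) :=
  (primitive u0.1 (poly2_comp P f.1 f.2), primitive u0.2 (poly2_comp Q f.1 f.2)).
pose f k := iter k step (u0.1%:P, u0.2%:P).
pose g k (t : R) := ((f k).1.[t], (f k).2.[t]).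
have [M M0 [PM PL]] := ev_lipschitz P (`|u0| + 1).
have [N N0 [QN QL]] := ev_lipschitz Q (`|u0| + 1).
have ball u : `|u - u0| <= 1 -> `|u| <= `|u0| + 1.
  by move=> uu0; rewrite -(subrK u0 u) addrC (le_trans (ler_normD _ _))// lerD2l.
have [h [h0 dh]] : exists h : R -> R * R,
  h 0 = u0 /\ \forall t \near (0 : R), is_derive (t : R) (1 : R) h (polyfield P Q (h t)).
  apply: (@picard_limit _ (polyfield P Q) u0 (M + N + 1) g).
  - by rewrite ltr_wpDl// addr_ge0.
  - move=> u /ball uu0; rewrite le_pair_norm /=.
    by have := PM _ uu0; have := QN _ uu0; move=> ? ?; apply/andP; split; lra.
  - move=> u v /ball uu0 /ball vu0; rewrite le_pair_norm /=.
    have := PL _ _ uu0 vu0; have := QL _ _ uu0 vu0 => Qle Ple.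
    by rewrite (le_trans Ple) ?(le_trans Qle)// ler_wpM2r//; lra.
  - by move=> t; rewrite /g /= !hornerC -surjective_pairing.
  - by case=> [|k]; rewrite /g /= ?hornerC ?horner0_primitive -surjective_pairing.
  - move=> k t; rewrite /polyfield /=; apply: is_derive_pair;
      by rewrite -horner_poly2_comp; exact: is_derive_primitive.
by exists h.
Qed.

End evaluation.

(** * The reduced systems in the charts at infinity *)

Section change_of_chart.
Variable R : realType.
Implicit Types (u v : R * R) (c : chart).

Lemma scale_pairE (l : R) u : l *: u = (l * u.1, l * u.2).
Proof. by []. Qed.

(** The differential at [u] of the change of variables [to_xy c], applied to
    [v]. *)
Definition dto_xy c u v : R * R :=
  match c with
  | Chart_xy => v
  | Chart_x => (- v.2 / u.2 ^+ 2, v.1 / u.2 - u.1 * v.2 / u.2 ^+ 2)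
  | Chart_y => (v.2 / u.1 - u.2 * v.1 / u.1 ^+ 2, - v.1 / u.1 ^+ 2)
  end.

Lemma is_derive_to_xy c u v : inf_coord c u != 0 ->
  is_derive u v (@to_xy R c) (dto_xy c u v).
Proof.
have d1 : is_derive u v fst v.1 by exact: (is_derive_fst (is_derive_id u v)).
have d2 : is_derive u v snd v.2 by exact: (is_derive_snd (is_derive_id u v)).
have dinv (f : R * R -> R) a : f u != 0 -> is_derive u v f a ->
    is_derive u v (fun y => (f y)^-1) (- a / f u ^+ 2).
  move=> fu0 df; have := is_derive_div fu0 (is_derive_cst (1 : R) u v) df.
  rewrite mul0r sub0r mul1r mulNr.
  by rewrite (_ : (fun y => _) = fun y => (f y)^-1)//; apply/funext => y; rewrite mul1r.
case: c => /= u0; first exact: is_derive_id.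
  by apply: is_derive_pair; [exact: dinv|exact: is_derive_div].
by apply: is_derive_pair; [exact: is_derive_div|exact: dinv].
Qed.

Lemma dto_xyZ c u l v : dto_xy c u (l *: v) = l *: dto_xy c u v.
Proof.
by case: c => //; rewrite /dto_xy !scale_pairE /=; congr pair; ring.
Qed.

Lemma dto_xy_inj c u : inf_coord c u != 0 -> injective (dto_xy c u).
Proof.
case: c => u0 [v1 v2] [w1 w2] //= [] e1 e2.
  have e : v2 = w2.
    move/(congr1 (fun z => - (z * u.2 ^+ 2))) : e1.
    by rewrite !divfK ?expf_neq0// !opprK.
  congr pair => //; move: e2; rewrite e => /addIr/(congr1 (fun z => z * u.2)).
  by rewrite !divfK.
have e : v1 = w1.
  move/(congr1 (fun z => - (z * u.1 ^+ 2))) : e2.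
  by rewrite !divfK ?expf_neq0// !opprK.
congr pair => //; move: e1; rewrite e => /addIr/(congr1 (fun z => z * u.1)).
by rewrite !divfK.
Qed.

Definition inf_var c : poly2 R :=
  match c with Chart_xy => 1 | Chart_x => vary R | Chart_y => varx R end.

Lemma ev_inf_var c u : ev (inf_var c) u.1 u.2 = inf_coord c u.
Proof. by case: c; rewrite /= ?evx ?evy// -(mpolyC1 2) evC. Qed.

(** Restricted to a line transverse to the line at infinity, p - q is a
    univariate polynomial that vanishes at all nonzero arguments. *)
Lemma ev_eq_off_infinity c (p q : poly2 R) : c <> Chart_xy ->
  (forall u, inf_coord c u != 0 -> ev p u.1 u.2 = ev q u.1 u.2) ->
  forall u, ev p u.1 u.2 = ev q u.1 u.2.
Proof.
move=> cxy pq u; apply/eqP; rewrite -subr_eq0 -evB; apply/eqP.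
pose f : {poly R} :=
  if c is Chart_x then poly2_comp (p - q) u.1%:P 'X
  else poly2_comp (p - q) 'X u.2%:P.
suff f0 : f = 0.
  have : f.[inf_coord c u] = 0 by rewrite f0 horner0.
  by move: cxy; rewrite /f; case: (c) => //= _; rewrite horner_poly2_comp hornerC hornerX.
apply: poly_eq0 => t t0; rewrite /f; move: cxy pq {f}.
case: c => // _ pq; rewrite horner_poly2_comp hornerC hornerX evB.
  by rewrite (pq (u.1, t)) ?subrr.
by rewrite (pq (t, u.2)) ?subrr.
Qed.

End change_of_chart.

Section projectively_singular_system.
Variables (R : realType) (n : nat) (D : system R n).
Hypothesis hD : projectively_singular D.
Implicit Types (u : R * R) (c : chart) (P Q : poly2 R).

Lemma evW i x y :
  ev (compW D i) x y = x * ev (compY D i) x y - y * ev (compX D i) x y.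
Proof. by rewrite evB !evM evx evy. Qed.

Lemma evW_homog i l x y : (i <= n)%N ->
  ev (compW D i) (l * x) (l * y) = l ^+ i.+1 * ev (compW D i) x y.
Proof.
move=> ni; rewrite !evW (ev_homog _ _ _ (compX_homog D ni)).
by rewrite (ev_homog _ _ _ (compY_homog D ni)) exprS; ring.
Qed.

Lemma top_proportional x y :
  x * ev (compY D n) x y = y * ev (compX D n) x y.
Proof. by apply/eqP; rewrite -subr_eq0 -evW hD. Qed.

(** W_n = 0 means x Y_n = y X_n, so X_n = 0 would force Y_n = 0. *)
Lemma topX_neq0 : exists2 xi, xi != 0 & ev (compX D n) 1 xi != 0.
Proof.
apply: contrapT => noX; apply: (@comp_top _ _ D).
have X0 x : x != 0 -> ev (compX D n) 1 x = 0.
  by move=> x0; apply/eqP/negPn/negP => Xx; apply: noX; exists x.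
split; apply: (@homog_eq0 _ n) => //; [exact: compX_homog|exact: compY_homog|].
by move=> x x0; have := top_proportional 1 x; rewrite X0// mulr0 mul1r.
Qed.

(** For constants X_0 and Y_0 the relation x Y_0 = y X_0 gives X_0 = 0. *)
Lemma degree_gt0 : (0 < n)%N.
Proof.
rewrite lt0n; apply/negP => /eqP n0.
have [xi _ /negP[]] := topX_neq0.
have cst (p : poly2 R) : homogeneous n p -> forall x y, ev p x y = ev p 0 0.
  by move=> hp x y; have := ev_homog 0 x y hp; rewrite !mul0r n0 expr0 mul1r.
have hX := cst _ (compX_homog D (leqnn n)).
have hY := cst _ (compY_homog D (leqnn n)).
have := top_proportional 1 0; have := top_proportional 1 1.
by rewrite !hX !hY !mul1r mul0r => <- ->.
Qed.

Lemma homogenize (p : nat -> poly2 R) (h x y : R) :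
  (forall i, (i <= n)%N -> homogeneous i (p i)) -> h != 0 ->
  \sum_(0 <= i < n.+1) h ^+ (n - i) * ev (p i) x y =
  h ^+ n * ev (\sum_(0 <= i < n.+1) p i) (x / h) (y / h).
Proof.
move=> hp h0; rewrite ev_sum mulr_sumr; apply: eq_big_nat => i /andP[_ ni].
rewrite ![_ / h]mulrC (ev_homog _ _ _ (hp i ni)) mulrA exprVn expfB_cond//.
by rewrite (negbTE h0) add0n.
Qed.

(** The summand of index n of the homogenized W is W_n = 0, so that one more
    factor h can be taken out: this is what distinguishes the reduction of a
    projectively singular system. *)
Lemma homogenizeW (h x y : R) : h != 0 ->
  h * \sum_(0 <= j < n) h ^+ (n - j - 1) * ev (compW D j) x y =
  h ^+ n * (x * ev (Defs.polyY D) (x / h) (y / h) - y * ev (Defs.polyX D) (x / h) (y / h)).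
Proof.
move=> h0; have -> : h * \sum_(0 <= j < n) h ^+ (n - j - 1) * ev (compW D j) x y
    = \sum_(0 <= j < n.+1) h ^+ (n - j) * ev (compW D j) x y.
  rewrite big_nat_recr//= hD mulr0 addr0 mulr_sumr.
  apply: eq_big_nat => j /andP[_ jn]; rewrite mulrA -exprS; congr (_ ^+ _ * _).
  by rewrite subn1 prednK// subn_gt0.
rewrite mulrBr mulrCA (mulrCA _ y) -!homogenize//; last 2 first.
- exact: compX_homog.
- exact: compY_homog.
by rewrite !mulr_sumr -sumrB; apply: eq_bigr => j _; rewrite evW; ring.
Qed.

(** The components of the reduced system of (D) in the chart [c]. *)
Definition chart_P c : poly2 R :=
  match c with
  | Chart_xy => Defs.polyX D
  | Chart_x => \sum_(0 <= j < n) vary R ^+ (n - j - 1) *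
                                 poly2_comp (compW D j) 1 (varx R)
  | Chart_y => - \sum_(0 <= i < n.+1) varx R ^+ (n - i) *
                                 poly2_comp (compY D i) (vary R) 1
  end.

Definition chart_Q c : poly2 R :=
  match c with
  | Chart_xy => Defs.polyY D
  | Chart_x => - \sum_(0 <= i < n.+1) vary R ^+ (n - i) *
                                 poly2_comp (compX D i) 1 (varx R)
  | Chart_y => - \sum_(0 <= j < n) varx R ^+ (n - j - 1) *
                                 poly2_comp (compW D j) (vary R) 1
  end.

Lemma chart_fieldE_x u : polyfield (chart_P Chart_x) (chart_Q Chart_x) u =
  first_reduced_field D u.
Proof.
case: u => xi th; rewrite /polyfield /=; congr pair; rewrite ?evN ev_sum.
  by apply: eq_bigr => j _;
    rewrite evM evXn evy ev_poly2_comp evx -(mpolyC1 2) evC.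
congr (- _); apply: eq_bigr => j _.
by rewrite evM evXn evy ev_poly2_comp evx -(mpolyC1 2) evC.
Qed.

Lemma chart_fieldE_y eta ze :
  polyfield (chart_P Chart_y) (chart_Q Chart_y) (eta, ze) =
  (- \sum_(0 <= i < n.+1) eta ^+ (n - i) * ev (compY D i) ze 1,
   - \sum_(0 <= j < n) eta ^+ (n - j - 1) * ev (compW D j) ze 1).
Proof.
rewrite /polyfield /=; congr pair; rewrite evN ev_sum; congr (- _);
by apply: eq_bigr => j _;
  rewrite evM evXn evx ev_poly2_comp evy -(mpolyC1 2) evC.
Qed.

Lemma sum_top m (f : nat -> R) :
  \sum_(0 <= i < m.+1) 0 ^+ (m - i) * f i = f m.
Proof.
rewrite big_nat_recr//= subnn expr0 mul1r big_nat big1 ?add0r// => i /andP[_ im].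
by rewrite expr0n subn_eq0 leqNgt im mul0r.
Qed.

Lemma sum_topW x y : \sum_(0 <= j < n) 0 ^+ (n - j - 1) * ev (compW D j) x y =
  ev (compW D (n - 1)) x y.
Proof.
rewrite -(sum_top (n - 1) (fun j => ev (compW D j) x y)).
by rewrite subn1 prednK ?degree_gt0//; apply: eq_bigr => j _; rewrite subnAC subn1.
Qed.

Lemma first_reduced_field_infinity xi :
  first_reduced_field D (xi, 0) =
  (ev (compW D (n - 1)) 1 xi, - ev (compX D n) 1 xi).
Proof. by rewrite /first_reduced_field sum_topW (sum_top n (fun i => ev _ 1 xi)). Qed.

Lemma chart_field_infinity_y ze :
  polyfield (chart_P Chart_y) (chart_Q Chart_y) (0, ze) =
  (- ev (compY D n) ze 1, - ev (compW D (n - 1)) ze 1).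
Proof. by rewrite chart_fieldE_y sum_topW (sum_top n (fun i => ev _ ze 1)). Qed.

(** The homogenized sums are h^n times X and Y at [to_xy c u], with h the
    coordinate [inf_coord c u]; the second-order pole of the differential of
    [to_xy] lowers the exponent by 2. *)
Lemma dto_xy_chart_field c u : c <> Chart_xy -> inf_coord c u != 0 ->
  dto_xy c u (polyfield (chart_P c) (chart_Q c) u) =
  (inf_coord c u ^ (n%:Z - 2)) *: polyfield (Defs.polyX D) (Defs.polyY D) (to_xy c u).
Proof.
case: c => // _; case: u => [a b] h0; rewrite expfzDr// -exprnP;
  rewrite ?chart_fieldE_x ?chart_fieldE_y /= in h0 *.
  have W := homogenizeW 1 a h0.
  rewrite (homogenize 1 a (compX_homog D) h0) -!/(Defs.polyX D).
  move: W; set S := \sum_(_ <= _ < _) _ => W.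
  have -> : S = b ^+ n * (1 * ev (Defs.polyY D) (1 / b) (a / b) -
     a * ev (Defs.polyX D) (1 / b) (a / b)) / b by rewrite -W mulrAC divff// mul1r.
  rewrite /polyfield /to_xy /= div1r scale_pairE /=.
  rewrite (_ : b ^ (- 2) = (b ^+ 2)^-1)//.
  by congr pair; field.
have W := homogenizeW b 1 h0.
rewrite (homogenize b 1 (compY_homog D) h0) -!/(Defs.polyY D).
move: W; set S := \sum_(_ <= _ < _) _ => W.
have -> : S = a ^+ n * (b * ev (Defs.polyY D) (b / a) (1 / a) -
   1 * ev (Defs.polyX D) (b / a) (1 / a)) / a by rewrite -W mulrAC divff// mul1r.
rewrite /polyfield /to_xy /= div1r scale_pairE /=.
rewrite (_ : a ^ (- 2) = (a ^+ 2)^-1)//.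
by congr pair; field.
Qed.

Lemma chart_field_infinity_neq0 c : c <> Chart_xy ->
  exists u, inf_coord c u = 0 /\ polyfield (chart_P c) (chart_Q c) u <> 0.
Proof.
have [xi xi0 Xn0] := topX_neq0; case: c => // _.
  exists (xi, 0); split=> //; rewrite chart_fieldE_x first_reduced_field_infinity.
  by case=> _ /eqP; rewrite oppr_eq0 (negbTE Xn0).
exists (0, xi^-1); split=> //; rewrite chart_field_infinity_y.
have := ev_homog xi^-1 1 xi (compY_homog D (leqnn n)).
rewrite mulr1 mulVf// => ->; case=> /eqP + _; rewrite oppr_eq0.
have := top_proportional 1 xi; rewrite mul1r => ->; apply/negP.
by rewrite !mulf_neq0// expf_neq0// invr_eq0.
Qed.

Lemma chart_field_reduced c : c <> Chart_xy ->
  reduced_system D c (chart_P c) (chart_Q c).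
Proof.
move=> cxy; suff : (exists m : int, forall u : R * R, inf_coord c u != 0 ->
    is_derive u (polyfield (chart_P c) (chart_Q c) u) (@to_xy R c)
      ((inf_coord c u ^ m) *: polyfield (Defs.polyX D) (Defs.polyY D) (to_xy c u)))
  /\ (exists u : R * R, inf_coord c u = 0 /\ polyfield (chart_P c) (chart_Q c) u <> 0).
  by case: c cxy.
split; last exact: chart_field_infinity_neq0.
exists (n%:Z - 2) => u u0; rewrite -dto_xy_chart_field//.
exact: is_derive_to_xy.
Qed.

(** Both sides are polynomial, so an identity off the line at infinity extends
    to it. *)
Lemma field_extends c P Q P' Q' k : c <> Chart_xy ->
  (forall u, inf_coord c u != 0 ->
     polyfield P Q u = (inf_coord c u ^+ k) *: polyfield P' Q' u) ->
  forall u, polyfield P Q u = (inf_coord c u ^+ k) *: polyfield P' Q' u.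
Proof.
move=> cxy off u; rewrite scale_pairE; apply/pair_equal_spec => /=.
rewrite -ev_inf_var -!evXn -!evM.
split; apply: (ev_eq_off_infinity cxy) => v v0;
  by have [e1 e2] := off v v0; rewrite evM evXn ev_inf_var.
Qed.

(** The differential of [to_xy] is injective off the line at infinity, so two
    reduced systems differ there by an integer power of [inf_coord c].  If
    the exponent were nonzero, the system that is a multiple of the other would
    vanish on the whole line. *)
Lemma reduced_system_unique c P Q : c <> Chart_xy -> reduced_system D c P Q ->
  forall u, polyfield P Q u = polyfield (chart_P c) (chart_Q c) u.
Proof.
move=> cxy red.
have [[m dPQ] [u1 [u10 PQu1]]] : (exists m : int, forall u : R * R, inf_coord c u != 0 ->
    is_derive u (polyfield P Q u) (@to_xy R c)
      ((inf_coord c u ^ m) *: polyfield (Defs.polyX D) (Defs.polyY D) (to_xy c u)))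
  /\ (exists u : R * R, inf_coord c u = 0 /\ polyfield P Q u <> 0).
  by case: c cxy red.
have [u2 [u20 Fu2]] := chart_field_infinity_neq0 cxy.
have PQF u : inf_coord c u != 0 -> polyfield P Q u =
    (inf_coord c u ^ (m - (n%:Z - 2))) *: polyfield (chart_P c) (chart_Q c) u.
  move=> u0; apply: (dto_xy_inj u0).
  rewrite dto_xyZ dto_xy_chart_field// scalerA -expfzDr// subrK.
  exact: is_derive_unique (is_derive_to_xy _ u0) (dPQ u u0).
case: (m - (n%:Z - 2)) PQF => k PQF.
  have PQFk := field_extends cxy PQF.
  case: k => [|k] in PQF PQFk *; first by move=> u; rewrite PQFk expr0 scale1r.
  by case: PQu1; rewrite PQFk u10 expr0n scale0r.
case: Fu2; rewrite (@field_extends c _ _ P Q k.+1 cxy) ?u20 ?expr0n ?scale0r// => u u0.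
by rewrite PQF// scalerA NegzE -exprnN divff ?scale1r// expf_neq0.
Qed.

End projectively_singular_system.

(** * Contact at infinity *)

Section theta_coordinate.
Variable R : realType.
Implicit Types (u : R * R) (c : chart) (k : R -> RP R).

(** The coordinate 1/x, extended by 0 to the line at infinity.  It is defined on
    the projective plane itself, which allows arcs given in different charts to
    be compared. *)
Definition theta (p : RP R) : R := if p is Defs.Finite (x, _) then x^-1 else 0.

Lemma theta_point_of_x u : theta (point_of Chart_x u) = u.2.
Proof. by rewrite /point_of /=; case: eqVneq => [->|]//=; rewrite invrK. Qed.

Lemma theta_point_of_y u : theta (point_of Chart_y u) = u.1 / u.2.
Proof.
rewrite /point_of /=; case: eqVneq => [->|u0] /=; last by rewrite invf_div.
by rewrite mul0r; case: eqP.
Qed.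

Lemma point_of_infinite c u a : point_of c u = Infinite a ->
  match c with
  | Chart_xy => False
  | Chart_x => u = (a, 0)
  | Chart_y => [/\ u.1 = 0, u.2 != 0 & u.2^-1 = a]
  end.
Proof.
rewrite /point_of; case: c => /=.
- by rewrite oner_eq0.
- by case: u => x y /=; case: eqVneq => // -> [->].
- by case: eqVneq => // u0; case: eqVneq => // u1 [].
Qed.

Lemma point_of_at_infinity c u : line_at_infinity (point_of c u) ->
  inf_coord c u = 0.
Proof. by rewrite /point_of; case: eqVneq. Qed.

Lemma is_derive_theta_x k g v : is_derive (0 : R) (1 : R) g v ->
  (\forall t \near (0 : R), k t = point_of Chart_x (g t)) ->
  is_derive (0 : R) (1 : R) (theta \o k) v.2.
Proof.
move=> dg kg; apply: (@near_eq_is_derive _ _ _ (fun t => (g t).2)).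
- by near=> t; rewrite /= (near kg t)// theta_point_of_x.
- exact: is_derive_snd.
Unshelve. all: by end_near. Qed.

Lemma is_derive_theta_y k g v : (g 0).1 = 0 -> (g 0).2 != 0 ->
  is_derive (0 : R) (1 : R) g v ->
  (\forall t \near (0 : R), k t = point_of Chart_y (g t)) ->
  is_derive (0 : R) (1 : R) (theta \o k) (v.1 / (g 0).2).
Proof.
move=> g1 g2 dg kg; apply: (@near_eq_is_derive _ _ _ (fun t => (g t).1 / (g t).2)).
- by near=> t; rewrite /= (near kg t)// theta_point_of_y.
- have := @is_derive_div _ _ (fun t => (g t).1) (fun t => (g t).2) _ _ _ _ g2
    (is_derive_fst dg) (is_derive_snd dg).
  by rewrite g1 !mul0r subr0.
Unshelve. all: by end_near. Qed.

(** An arc drawn on a coordinate axis has its velocity on that axis, and a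
    vector collinear with a nonzero vector of the axis lies on it. *)
Lemma tangent_axis (L : set (R * R)) (l : R * R -> R) g :
  (l = fst) \/ (l = snd) -> (forall u, L u -> l u = 0) -> tangent_to L g ->
  exists2 v, is_derive (0 : R) (1 : R) g v & l v = 0.
Proof.
move=> lE L0 [s [v [w [s0 Ls [dg ds] [_ w0] vw]]]]; exists v => //.
have ls : is_derive (0 : R) (1 : R) (l \o s) (l w).
  by case: lE => ->; [exact: is_derive_fst|exact: is_derive_snd].
have lw : l w = 0.
  apply: is_derive_unique ls _.
  apply: (@near_eq_is_derive _ _ _ (cst 0)).
  by near=> t; rewrite /= L0//; near: t.
case: lE lw => -> lw; rewrite lw in vw.
  have w2 : w.2 != 0.
    by apply: contra_neq w0 => w2; rewrite [w]surjective_pairing lw w2.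
  by apply/eqP; move/eqP: vw; rewrite mulr0 subr0 mulf_eq0 (negbTE w2) orbF.
have w1 : w.1 != 0.
  by apply: contra_neq w0 => w1; rewrite [w]surjective_pairing lw w1.
by apply/eqP; move/eqP: vw; rewrite mulr0 sub0r oppr_eq0 mulf_eq0 (negbTE w1) orbF.
Unshelve. all: by end_near. Qed.

Lemma tangent_theta k a : k 0 = Infinite a ->
  RP_tangent_to (@line_at_infinity R) k ->
  is_derive (0 : R) (1 : R) (theta \o k) 0.
Proof.
move=> k0 [c [g [kg tg]]].
have g0 : point_of c (g 0) = Infinite a by rewrite -k0 (nbhs_singleton kg).
have := point_of_infinite g0; case: c => // in kg tg g0 * => [_|[g1 g2 _]].
- have [v dg v2] : exists2 v, is_derive (0 : R) (1 : R) g v & v.2 = 0.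
    apply: tangent_axis tg; first by right.
    exact: point_of_at_infinity.
  by have := is_derive_theta_x dg kg; rewrite v2.
- have [v dg v1] : exists2 v, is_derive (0 : R) (1 : R) g v & v.1 = 0.
    apply: tangent_axis tg; first by left.
    exact: point_of_at_infinity.
  by have := is_derive_theta_y g1 g2 dg kg; rewrite v1 mul0r.
Qed.

End theta_coordinate.

Section contact_at_infinity.
Variables (R : realType) (n : nat) (D : system R n).
Hypothesis hD : projectively_singular D.
Variable a : R.

Definition contact_condition : Prop :=
  ev (compX D n) 1 a = 0 /\ ev (compW D (n - 1)) 1 a <> 0.

(** The factor [c] depends on the chart, because each reduced system uses its
    own change of time. *)
Lemma trajectory_theta k : k 0 = Infinite a -> RP_trajectory D k ->
  exists2 c, c != 0 &
    is_derive (0 : R) (1 : R) (@theta R \o k) (c * ev (compX D n) 1 a).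
Proof.
move=> k0 [c [P [Q [g [red sol kg]]]]].
have dg := nbhs_singleton sol.
have g0 : point_of c (g 0) = Infinite a by rewrite -k0 (nbhs_singleton kg).
have := point_of_infinite g0; case: c => // in red kg g0 *.
  move=> g0E; exists (-1); first by rewrite oppr_eq0 oner_eq0.
  have := is_derive_theta_x dg kg.
  rewrite (reduced_system_unique hD _ red)// g0E chart_fieldE_x.
  by rewrite first_reduced_field_infinity// mulN1r.
(* In the chart (eta, zeta) the point is (0, z) with z = 1/a, where eta has
   derivative - Y_n(z, 1) = - z^n Y_n(1, a) = - z^n a X_n(1, a). *)
move=> [g1 g2 ga]; have := is_derive_theta_y g1 g2 dg kg.
rewrite (reduced_system_unique hD _ red)// [g 0]surjective_pairing g1.
rewrite chart_field_infinity_y//= => dk.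
set z := (g 0).2 in g2 ga dk *.
exists (- (z ^+ n * a / z)).
  by rewrite oppr_eq0 -ga !mulf_neq0 ?expf_neq0 ?invr_eq0.
have := ev_homog z 1 a (compY_homog D (leqnn n)).
have := top_proportional hD 1 a; rewrite mul1r => ->.
rewrite mulr1 -{1}ga divff// => Yz.
apply: (is_derive_eq dk); rewrite Yz; ring.
Qed.

(** In the chart (eta, zeta) the second component of the reduced system at
    (0, 1/a) is - W_{n-1}(1/a, 1), which is W_{n-1}(1, a) up to a nonzero factor
    by homogeneity. *)
Lemma not_equilibrium : ev (compW D (n - 1)) 1 a <> 0 ->
  ~ RP_equilibrium D (Infinite a).
Proof.
move=> /eqP W0 [c [P [Q [u [red pu eq0]]]]].
have := point_of_infinite pu; case: c => // in red pu * => [ua|[u1 u2 ua]].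
  move: eq0; rewrite (reduced_system_unique hD _ red)// ua chart_fieldE_x.
  by rewrite first_reduced_field_infinity// => -[] /eqP; rewrite (negbTE W0).
move: eq0; rewrite (reduced_system_unique hD _ red)// [u]surjective_pairing u1.
rewrite chart_field_infinity_y// => -[_] /eqP.
have := evW_homog D u.2 1 a (leq_subr 1 n); rewrite mulr1 -{1}ua divff// => ->.
by rewrite oppr_eq0 mulf_eq0 (negbTE W0) orbF expf_eq0 (negbTE u2) andbF.
Qed.

Lemma solution_through_infinity : exists g : R -> R * R,
  solution (first_reduced_field D) g /\ g 0 = (a, 0).
Proof.
have [g [sol g0]] := polyfield_solution (chart_P D Chart_x) (chart_Q D Chart_x) (a, 0).
by exists g; split => //; near=> t; rewrite -chart_fieldE_x; near: t.
Unshelve. all: by end_near. Qed.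

(** Stated for any [L] that contains the axis theta = 0, to serve both for the
    line theta = 0 itself and for the preimage of the line at infinity. *)
Lemma tangent_to_infinity (L : set (R * R)) g :
  contact_condition -> (forall x, L (x, 0)) ->
  solution (first_reduced_field D) g -> g 0 = (a, 0) -> tangent_to L g.
Proof.
move=> [X0 W0] Lx sol g0.
exists (fun t => (t + a, 0)), (first_reduced_field D (g 0)), (1, 0); split.
- by rewrite add0r.
- by near=> t; exact: Lx.
- split; first exact: (nbhs_singleton sol).
  by apply: is_derive_pair; exact: is_derive_shift.
- rewrite g0 first_reduced_field_infinity// X0 oppr0.
  by split; apply/eqP => -[]// /eqP; rewrite oner_eq0.
- by rewrite g0 first_reduced_field_infinity//= X0 oppr0 mulr0 mul0r subr0.
Unshelve. all: by end_near. Qed.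

Lemma contact_pointE :
  contact_point (first_reduced_field D) [set u : R * R | u.2 = 0] (a, 0) <->
  contact_condition.
Proof.
split=> [[_ reg [g [sol g0 tg]]]|cc].
  have [v dg v2] : exists2 v, is_derive (0 : R) (1 : R) g v & v.2 = 0.
    by apply: tangent_axis tg => //; right.
  have vE : v = first_reduced_field D (a, 0).
    by rewrite -g0; exact: is_derive_unique dg (nbhs_singleton sol).
  move: reg v2; rewrite vE first_reduced_field_infinity//= => reg /eqP.
  rewrite oppr_eq0 => /eqP X0; split=> // W0.
  by apply: reg; rewrite X0 W0 oppr0.
have [g [sol g0]] := solution_through_infinity; split=> //.
  by rewrite first_reduced_field_infinity// => -[W0 _]; case: cc.
by exists g; split=> //; exact: tangent_to_infinity.
Qed.

Lemma equatorial_contact_pointE :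
  equatorial_contact_point D (Infinite a) <-> contact_condition.
Proof.
split=> [[_ reg [k [traj k0 tg]]]|cc].
  have [c c0 dk] := trajectory_theta k0 traj.
  have X0 : ev (compX D n) 1 a = 0.
    have /eqP := is_derive_unique dk (tangent_theta k0 tg).
    by rewrite mulf_eq0 (negbTE c0) => /eqP.
  split=> // W0; apply: reg.
  exists Chart_x, (chart_P D Chart_x), (chart_Q D Chart_x), (a, 0); split.
  - exact: chart_field_reduced.
  - by rewrite /point_of /= eqxx.
  - by rewrite chart_fieldE_x first_reduced_field_infinity// X0 W0 oppr0.
have [g [sol g0]] := solution_through_infinity; split=> //.
  by apply: not_equilibrium; case: cc.
exists (fun t => point_of Chart_x (g t)); split.
- exists Chart_x, (chart_P D Chart_x), (chart_Q D Chart_x), g; split=> //.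
  + exact: chart_field_reduced.
  + by near=> t; rewrite chart_fieldE_x; near: t.
  + by near=> t.
- by rewrite g0 /point_of /= eqxx.
- exists Chart_x, g; split; first by near=> t.
  apply: tangent_to_infinity => // x.
  by rewrite /preimage /= /point_of /= eqxx.
Unshelve. all: by end_near. Qed.

End contact_at_infinity.

Theorem mainTheorem16 (R : realType) (n : nat) (D : system R n)
    (hD : projectively_singular D) (a : R) :
  (equatorial_contact_point D (Infinite a) <->
   contact_point (first_reduced_field D) [set u : R * R | u.2 = 0] (a, 0))
  /\
  (contact_point (first_reduced_field D) [set u : R * R | u.2 = 0] (a, 0) <->
   (ev (compX D n) 1 a = 0 /\ ev (compW D (n - 1)) 1 a <> 0)).
Proof.
split; last exact: contact_pointE.
exact: (iff_trans (equatorial_contact_pointE hD a) (iff_sym (contact_pointE hD a))).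
Qed.
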